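(* Let $X$ be a Calabi-Yau complete intersection in a toric variety $Y$ corresponding to a nef partition, and consider the Tyurin degeneration of $X$ given by a refinement $L_0=L_{0,1}\otimes L_{0,2}$ of the nef partition, with associated quasi-Fano varieties $X_1$ and $\tilde X_2$ (where $\tilde X_2$ is a blow-up of $X_2$) and common smooth anticanonical divisor $X_0$, as set up in the context. Let $f_0^{X}(q)$, $f_0^{X_0}(q)$, $f_0^{X_1}(q,y)$, $f_0^{\tilde X_2}(q,y)$ be the holomorphic periods of the mirrors of $X$, $X_0$, $X_1$, $\tilde X_2$ respectively, given by the explicit series in the context. Then $$f_0^{X}(q)\star_q f_0^{X_0}(q)=\frac{1}{2\pi i}\oint f_0^{X_1}(q,y)\star_q f_0^{\tilde{X}_2}(q,y)\frac{dy}{y}.$$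
   Context: **Geometry.** $Y$ is a smooth projective toric variety with toric divisor classes $D_1,\dots,D_m\in H^2(Y,\mathbb Z)$ and a nef integral basis $p_1,\dots,p_r$ of $H^2(Y,\mathbb Z)$; write $D_j=\sum_{i=1}^r m_{ij}p_i$. A nef partition is a partition of the set of toric divisors into $s+1$ groups, indexed by $l=0,\dots,s$, such that for each $l$ the sum $\rho_l$ of the classes $D_j$ in group $l$ is $c_1(L_l)$ for a nef line bundle $L_l$; thus $-K_Y=\sum_{l=0}^s\rho_l$. $X\subset Y$ is the Calabi-Yau complete intersection cut out by a generic section $(s_0,\dots,s_s)$ of $L_0\oplus\cdots\oplus L_s$. A refinement with respect to $L_0$ is a splitting of group $0$ into two groups, $\{D_{j_1},\dots,D_{j_a}\}$ and $\{D_{j_{a+1}},\dots,D_{j_{a+b}}\}$, with sums $\rho_{0,1}=c_1(L_{0,1})$ and $\rho_{0,2}=c_1(L_{0,2})$, where $L_{0,1},L_{0,2}$ are nef line bundles and $L_0=L_{0,1}\otimes L_{0,2}$ (so $\rho_0=\rho_{0,1}+\rho_{0,2}$). $X_1$ and $X_2$ are the quasi-Fano complete intersections defined by generic sections of $L_{0,1}\oplus L_1\oplus\cdots\oplus L_s$ and $L_{0,2}\oplus L_1\oplus\cdots\oplus L_s$, with $s_{0,1},s_{0,2}$ the corresponding sections of $L_{0,1},L_{0,2}$. $\tilde X_2$ is the blow-up of $X_2$ along $X_2\cap\{s_0=0\}\cap\{s_{0,1}=0\}$. $X_0=X_1\cap\tilde X_2$ is the Calabi-Yau complete intersection in $Y$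 defined by a generic section of $L_{0,1}\oplus L_{0,2}\oplus L_1\oplus\cdots\oplus L_s$. $X$ degenerates to $X_1\cup_{X_0}\tilde X_2$ (Tyurin degeneration). **Periods.** Let $q=(q_1,\dots,q_r)$ and $q^d=q_1^{\langle p_1,d\rangle}\cdots q_r^{\langle p_r,d\rangle}$ for $d\in H_2(Y;\mathbb Z)$. All sums below run over $d\in H_2(Y;\mathbb Z)$ with $\langle D_j,d\rangle\ge 0$ for all $j$. The holomorphic periods of the (Hori-Vafa) mirror Calabi-Yau families and Landau-Ginzburg models, after identifying the complex parameters of the mirrors, are $$f_0^{X}(q)=\sum_{d}\frac{\prod_{l=0}^s\langle\rho_l,d\rangle!}{\prod_{j=1}^m\langle D_j,d\rangle!}q^d,\qquad f_0^{X_0}(q)=\sum_{d}\frac{\prod_{l=1}^s\langle\rho_l,d\rangle!}{\prod_{j=1}^m\langle D_j,d\rangle!}\langle\rho_{0,1},d\rangle!\,\langle\rho_{0,2},d\rangle!\,q^d,$$ $$f_0^{X_1}(q,y)=\sum_{d}\frac{\prod_{l=1}^s\langle\rho_l,d\rangle!}{\prod_{j=1}^m\langle D_j,d\rangle!}\langle\rho_{0,1},d\rangle!\,\langle\rho_{0,2},d\rangle!\,\frac{q^d}{y^{\langle\rho_{0,2},d\rangle}},$$ $$f_0^{\tilde X_2}(q,y)=\sum_{d}\sum_{d_0\ge0}\frac{\prod_{l=1}^s\langle\rho_l,d\rangle!}{\prod_{j=1}^m\langle D_j,d\rangle!}\frac{(d_0+\langle\rho_{0,1},d\rangle)!\,\langle\rho_{0,2},d\rangle!}{d_0!}\,q^d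 y^{d_0}.$$ **Conventions.** The Hadamard product with respect to $q$ is $\left(\sum_d a_dq^d\right)\star_q\left(\sum_d b_dq^d\right)=\sum_d a_db_dq^d$, where $a_d,b_d$ may depend on other variables (here $y$). The integral $\frac1{2\pi i}\oint(\cdot)\frac{dy}{y}$ is the residue integral over a loop around $y=0$ (in the region of convergence of the series), i.e. it extracts the coefficient of $y^0$. *)

(* Defs.v *)
From mathcomp Require Export all_boot all_order all_algebra.
From mathcomp Require Export complex.
From mathcomp Require Export all_classical all_reals all_analysis.

Set Implicit Arguments.
Unset Strict Implicit.
Unset Printing Implicit Defensive.

Export Order.TTheory GRing.Theory Num.Theory.
Export numFieldNormedType.Exports.

Local Open Scope classical_set_scope.
Local Open Scope ring_scope.
Local Open Scope complex_scope.

(** The lattice is N = Z^n, with dual M = Z^n.  The primitive ray generators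
    are the rows of an integer matrix [V], one for each toric divisor D_j, and
    a cone is given by the set of indices of the rays that span it. *)

Definition cone (R : realType) (n m : nat) (V : 'M[int]_(m, n))
    (sigma : {set 'I_m}) : set 'rV[R]_n :=
  [set x | exists2 c : 'rV[R]_m,
     forall j, 0 <= c 0 j /\ (j \notin sigma -> c 0 j = 0)
     & x = c *m map_mx intr V].

(** A torus-invariant divisor sum_j a_j D_j is the row vector a, and the
    character u of M has divisor sum_j <u, v_j> D_j.  In the two predicates
    below, [u] is a section of O(D): it is regular when D + div(u) is
    effective, and it generates O(D) over the affine chart of [sigma] when
    D + div(u) vanishes on that chart. *)
Definition divisor_of (n m : nat) (V : 'M[int]_(m, n)) (u : 'rV[int]_n) :
  'rV[int]_m := u *m V^T.

Definition lin_equiv (n m : nat) (V : 'M[int]_(m, n)) (a b : 'rV[int]_m) :=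
  exists u : 'rV[int]_n, a = b + divisor_of V u.

(** The support function of D is convex; on a complete toric variety this is
    nefness (equivalently, global generation). *)
Definition nef_divisor (n m : nat) (V : 'M[int]_(m, n))
    (Sigma : {set {set 'I_m}}) (a : 'rV[int]_m) :=
  forall sigma, sigma \in Sigma -> exists u : 'rV[int]_n, forall j,
    0 <= (a + divisor_of V u) 0 j /\
    (j \in sigma -> (a + divisor_of V u) 0 j = 0).

(** The support function of D is strictly convex; in a complete smooth fan
    the maximal cones are those with n rays. *)
Definition ample_divisor (n m : nat) (V : 'M[int]_(m, n))
    (Sigma : {set {set 'I_m}}) (a : 'rV[int]_m) :=
  forall sigma, sigma \in Sigma -> #|sigma| = n ->
    exists u : 'rV[int]_n, forall j,
      if j \in sigma then (a + divisor_of V u) 0 j = 0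
      else 0 < (a + divisor_of V u) 0 j.

Record smooth_projective_toric (R : realType) (n m : nat) := SmoothProjToric {
  rays : 'M[int]_(m, n);
  fan : {set {set 'I_m}};
  fan_rays : forall j, [set j]%SET \in fan;
  fan_faces : forall sigma tau : {set 'I_m},
    sigma \in fan -> tau \subset sigma -> tau \in fan;
  fan_meet : forall sigma tau, sigma \in fan -> tau \in fan ->
    @cone R n m rays sigma `&` cone rays tau = cone rays (sigma :&: tau)%SET;
  fan_smooth : forall sigma, sigma \in fan ->
    exists (b : 'M[int]_n) (f : 'I_m -> 'I_n),
      [/\ b \in unitmx, {in sigma &, injective f}
        & forall j, j \in sigma -> row j rays = row (f j) b];
  fan_complete : forall x : 'rV[R]_n,
    exists2 sigma, sigma \in fan & cone rays sigma x;
  fan_projective : exists a, ample_divisor rays fan a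
}.

(** H^2(Y, Z) is Z^m modulo linear equivalence.  Row i of [basis_div] is a
    divisor representing p_i, and [basis_coef] i j is the integer m_ij with
    D_j = sum_i m_ij p_i in H^2(Y, Z). *)
Record nef_basis (R : realType) (n m : nat)
    (Y : smooth_projective_toric R n m) (r : nat) := NefBasis {
  basis_div : 'M[int]_(r, m);
  basis_coef : 'M[int]_(r, m);
  basis_div_basis : forall a : 'rV[int]_m,
    exists! c : 'rV[int]_r, lin_equiv (rays Y) a (c *m basis_div);
  basis_div_nef : forall i, nef_divisor (rays Y) (fan Y) (row i basis_div);
  basis_coefP : forall j,
    lin_equiv (rays Y) (delta_mx 0 j)
      (\sum_(i < r) basis_coef i j *: row i basis_div)
}.

Definition sum_div (m : nat) (J : {set 'I_m}) : 'rV[int]_m :=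
  \sum_(j in J) delta_mx 0 j.

Record nef_partition (R : realType) (n m : nat)
    (Y : smooth_projective_toric R n m) (s : nat) := NefPartition {
  nef_group : 'I_s.+1 -> {set 'I_m};
  nef_group_inj : injective nef_group;
  nef_group_part : finset.partition [set nef_group l | l : 'I_s.+1]%SET
    (finset.setT : {set 'I_m});
  nef_group_nef : forall l,
    nef_divisor (rays Y) (fan Y) (sum_div (nef_group l))
}.

Record refinement (R : realType) (n m : nat)
    (Y : smooth_projective_toric R n m) (s : nat) (P : nef_partition Y s) :=
  Refinement {
  group01 : {set 'I_m};
  group02 : {set 'I_m};
  group01_neq0 : group01 != finset.set0;
  group02_neq0 : group02 != finset.set0;
  group0_disj : fintype.disjoint (mem group01) (mem group02);
  group0_split : nef_group P ord0 = (group01 :|: group02)%SET;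
  group01_nef : nef_divisor (rays Y) (fan Y) (sum_div group01);
  group02_nef : nef_divisor (rays Y) (fan Y) (sum_div group02)
}.

(** H_2(Y, Z) is the dual of H^2(Y, Z); d is given by its coordinates
    d_i = <p_i, d> in the basis dual to p_1, ..., p_r, so that d is also the
    exponent of the monomial q^d.  A series sum_d a_d q^d is the family of its
    coefficients; a_d lies in R[i], or is a function of y in R[i]. *)
Definition qseries (r : nat) (A : Type) := 'rV[int]_r -> A.

Definition hadamard (r : nat) (A : pzRingType) (f g : qseries r A) :
  qseries r A := fun d => f d * g d.

Section ContourIntegral.
Variable R : realType.

Definition complex_integral (D : set R) (f : R -> R[i]) : R[i] :=
  (\int[lebesgue_measure]_(t in D) complex.Re (f t)) +i*
  (\int[lebesgue_measure]_(t in D) complex.Im (f t)).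

(** The integral of g(y) dy over the circle y = eps * exp(i t), 0 <= t <= 2pi. *)
Definition circle_integral (eps : R) (g : R[i] -> R[i]) : R[i] :=
  complex_integral `[0, 2 * pi]
    (fun t => g (eps%:C * (cos t +i* sin t)) *
              (eps%:C * (- sin t +i* cos t))).

(** (1 / 2 pi i) * contour integral of f(q, y) dy / y over |y| = eps,
    coefficientwise in q. *)
Definition contour_dy_over_y (r : nat) (eps : R)
    (f : qseries r (R[i] -> R[i])) : qseries r R[i] :=
  fun d => ((2 * pi)%:C * 'i)^-1 * circle_integral eps (fun y => f d y / y).

End ContourIntegral.

(** [zfact k] is k! for k >= 0; it is only applied to nonnegative integers,
    since the coefficients below are 0 unless <D_j, d> >= 0 for all j. *)
Definition zfact (k : int) : nat := (`|k|%N)`!%N.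

Section Periods.
Variables (R : realType) (n m r s : nat) (Y : smooth_projective_toric R n m).
Variables (B : nef_basis Y r) (P : nef_partition Y s) (Q : refinement P).

(** <D_j, d> *)
Definition pairD (j : 'I_m) (d : 'rV[int]_r) : int :=
  \sum_(i < r) basis_coef B i j * d 0 i.

Definition pairS (J : {set 'I_m}) (d : 'rV[int]_r) : int :=
  \sum_(j in J) pairD j d.

Definition effective (d : 'rV[int]_r) : bool := [forall j, 0 <= pairD j d].

Definition period_X : qseries r R[i] := fun d =>
  if effective d then
    (\prod_(l < s.+1) zfact (pairS (nef_group P l) d))%N%:R /
    (\prod_(j < m) zfact (pairD j d))%N%:R
  else 0.

(** prod_(l = 1..s) <rho_l, d>! / prod_j <D_j, d>! *)
Definition common_factor (d : 'rV[int]_r) : R[i] :=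
  (\prod_(l < s.+1 | l != ord0) zfact (pairS (nef_group P l) d))%N%:R /
  (\prod_(j < m) zfact (pairD j d))%N%:R.

Definition period_X0 : qseries r R[i] := fun d =>
  if effective d then
    common_factor d * (zfact (pairS (group01 Q) d))%:R
                    * (zfact (pairS (group02 Q) d))%:R
  else 0.

Definition period_X1 : qseries r (R[i] -> R[i]) := fun d y =>
  if effective d then
    common_factor d * (zfact (pairS (group01 Q) d))%:R
                    * (zfact (pairS (group02 Q) d))%:R
                    / y ^ pairS (group02 Q) d
  else 0.

(** The inner sum over d_0 >= 0 has radius of convergence 1 in y. *)
Definition period_tX2 : qseries r (R[i] -> R[i]) := fun d y =>
  if effective d then
    limn (series (fun d0 : nat =>
      common_factor d *
      ((zfact (d0%:Z + pairS (group01 Q) d))%:R *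
       (zfact (pairS (group02 Q) d))%:R / (d0`!)%:R) * y ^+ d0 : R[i]^o))
  else 0.

End Periods.

(* Main.v *)
Require Import Defs.
From mathcomp Require Import measurable_realfun ring.

(** Everything happens coefficientwise in q.  Both sides vanish unless all
    <D_j, d> are nonnegative; for such an exponent d, put a = <rho_(0,1), d> and
    b = <rho_(0,2), d>, which are natural numbers with a + b = <rho_0, d>.  With K
    the factor that all four periods share, the integrand on the right is

      (K a! b! / y^b) * sum_k K b! ((k + a)! / k!) y^k,

    and its residue against dy / y is the term k = b of the sum, namely
    K a! b! * K (a + b)!.  This is also the product of the coefficient
    K (a + b)! of the period of X, where <rho_0, d>! has been split off
    ([period_X_factor], [pairS_group0]), with the coefficient K a! b! of the
    period of X_0.

    The analytic content is that the contour integral of a convergent power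
    series picks out a coefficient ([cauchy_coefficient]).  On the circle
    y = eps * exp(i t) the partial sums are finite combinations of the
    exponentials exp(i (k - b) t), whose integrals over a full turn vanish
    unless k = b; so the integral of the partial sums is constant as soon as the
    index b has been reached.  A convergent majorant series bounds all
    partial sums at once, so dominated convergence ([complex_dominated_cvg])
    passes this constant to the integral of the sum.  The integral is defined
    through real and imaginary parts, and the modulus controls both of them.

    The majorant is, up to a constant, the series of C(k + a, a) eps^k, whose
    partial sums are at most (1 - eps)^-(a + 1) ([binomial_partial_sum_le]); this
    is where eps < 1 is needed. *)

Set Implicit Arguments.
Unset Strict Implicit.
Unset Printing Implicit Defensive.

Local Open Scope classical_set_scope.
Local Open Scope ring_scope.
Local Open Scope complex_scope.

Local Notation Re := complex.Re.
Local Notation Im := complex.Im.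

(** * Real and imaginary parts, and convergence of complex series *)

Lemma ReD (R : realType) (x y : R[i]) : Re (x + y) = Re x + Re y.
Proof. by case: x y => [a b] [c d]. Qed.

Lemma ImD (R : realType) (x y : R[i]) : Im (x + y) = Im x + Im y.
Proof. by case: x y => [a b] [c d]. Qed.

Lemma ReB (R : realType) (x y : R[i]) : Re (x - y) = Re x - Re y.
Proof. by case: x y => [a b] [c d]. Qed.

Lemma ImB (R : realType) (x y : R[i]) : Im (x - y) = Im x - Im y.
Proof. by case: x y => [a b] [c d]. Qed.

Lemma ReM (R : realType) (x y : R[i]) : Re (x * y) = Re x * Re y - Im x * Im y.
Proof. by case: x y => [a b] [c d]. Qed.

Lemma ImM (R : realType) (x y : R[i]) : Im (x * y) = Re x * Im y + Im x * Re y.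
Proof. by case: x y => [a b] [c d]. Qed.

Lemma Re_sum (R : realType) (I : Type) (r : seq I) (P : pred I) (F : I -> R[i]) :
  Re (\sum_(i <- r | P i) F i) = \sum_(i <- r | P i) Re (F i).
Proof. by elim/big_rec2: _ => // i x y _ <-; rewrite ReD. Qed.

Lemma Im_sum (R : realType) (I : Type) (r : seq I) (P : pred I) (F : I -> R[i]) :
  Im (\sum_(i <- r | P i) F i) = \sum_(i <- r | P i) Im (F i).
Proof. by elim/big_rec2: _ => // i x y _ <-; rewrite ImD. Qed.

Lemma norm_i (R : realType) : `|'i%C| = 1 :> R[i].
Proof. by rewrite normc_def /= expr0n expr1n add0r sqrtr1. Qed.

Lemma norm_realc (R : realType) (x : R) : `|x%:C| = `|x|%:C.
Proof. by rewrite normc_def /= expr0n addr0 sqrtr_sqr. Qed.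

Lemma normc_ge_Im (R : realType) (x : R[i]) : `|Im x|%:C <= `|x|.
Proof.
by rewrite -normrN -ReiNIm (le_trans (normc_ge_Re _))// normrM norm_i mulr1.
Qed.

Lemma le_normc_ReIm (R : realType) (x : R[i]) : `|x| <= (`|Re x| + `|Im x|)%:C.
Proof.
rewrite {1}(complexE x) (le_trans (ler_normD _ _))// normrM norm_i mul1r.
by rewrite !norm_realc rmorphD.
Qed.

Lemma cvg_complexP (R : realType) (u : nat -> R[i]^o) (l : R[i]^o) :
  u @ \oo --> l <->
  (fun n => Re (u n)) @ \oo --> Re l /\ (fun n => Im (u n)) @ \oo --> Im l.
Proof.
split=> [ul|[ul1 ul2]].
  split; apply/cvgrPdist_lt => e e0.
    have := (cvgrPdist_lt _ _).1 ul e%:C; rewrite ltcR => /(_ _ e0).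
    apply: filterS => n; rewrite -ltcR; apply: le_lt_trans.
    by rewrite -ReB normc_ge_Re.
  have := (cvgrPdist_lt _ _).1 ul e%:C; rewrite ltcR => /(_ _ e0).
  apply: filterS => n; rewrite -ltcR; apply: le_lt_trans.
  by rewrite -ImB normc_ge_Im.
apply/cvgrPdist_lt => -[e e']; rewrite ltcE /= => /andP[/eqP -> e0].
have e20 : 0 < e / 2 by rewrite divr_gt0.
(* Half of the error is allotted to each part. *)
have h1 := (cvgrPdist_lt _ _).1 ul1 _ e20; have h2 := (cvgrPdist_lt _ _).1 ul2 _ e20.
near=> n; apply: le_lt_trans; first exact: le_normc_ReIm.
rewrite ltcR [e in _ < e]splitr.
rewrite ReB ImB ltrD//; near: n; [exact: h1|exact: h2].
Unshelve. all: by end_near.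
Qed.

(** The completeness of the complex numbers is obtained from that of the reals:
    the real and imaginary parts converge absolutely. *)
Lemma is_cvg_series_complex (R : realType) (c : nat -> R[i]) (a : nat -> R) :
  (forall k, `|c k| <= (a k)%:C) -> cvgn (series a) ->
  cvgn (series (c : nat -> R[i]^o)).
Proof.
move=> ca cva.
have a0 k : 0 <= a k by rewrite -ler0c (le_trans _ (ca k)).
have cvRe : cvgn (series (fun k => Re (c k))).
  apply: normed_cvg; apply: series_le_cvg cva => //= k.
  by rewrite -lecR (le_trans (normc_ge_Re _)).
have cvIm : cvgn (series (fun k => Im (c k))).
  apply: normed_cvg; apply: series_le_cvg cva => //= k.
  by rewrite -lecR (le_trans (normc_ge_Im _)).
apply/cvg_ex; exists (limn (series (fun k => Re (c k))) +i*
                      limn (series (fun k => Im (c k)))).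
apply/cvg_complexP; split => /=.
  rewrite (_ : (fun n => _) = series (fun k => Re (c k)))//.
  by apply/funext => n; rewrite /series/= Re_sum.
rewrite (_ : (fun n => _) = series (fun k => Im (c k)))//.
by apply/funext => n; rewrite /series/= Im_sum.
Qed.

(** * Complex integrals over a set of reals *)

Definition cintegrable (R : realType) (D : set R) (f : R -> R[i]) : Prop :=
  lebesgue_measure.-integrable D (EFin \o (fun t => Re (f t))) /\
  lebesgue_measure.-integrable D (EFin \o (fun t => Im (f t))).

Section ComplexIntegral.
Context (R : realType) (D : set R) (mD : measurable D).
Implicit Types (f g : R -> R[i]) (z : R[i]).

Lemma cintegrableD f g : cintegrable D f -> cintegrable D g ->
  cintegrable D (fun t => f t + g t).
Proof.
move=> [f1 f2] [g1 g2]; split.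
- under [EFin \o _]eq_fun do rewrite /= ReD EFinD; exact: integrableD.
- under [EFin \o _]eq_fun do rewrite /= ImD EFinD; exact: integrableD.
Qed.

Lemma complex_integralD f g : cintegrable D f -> cintegrable D g ->
  complex_integral D (fun t => f t + g t) =
  complex_integral D f + complex_integral D g.
Proof.
move=> [f1 f2] [g1 g2]; rewrite /complex_integral.
under eq_Rintegral do rewrite ReD.
under [X in _ +i* X]eq_Rintegral do rewrite ImD.
by rewrite !RintegralD.
Qed.

Lemma cintegrableZ z f : cintegrable D f -> cintegrable D (fun t => z * f t).
Proof.
have iZ (r : R) h : lebesgue_measure.-integrable D (EFin \o h) ->
    lebesgue_measure.-integrable D (fun t => (r * h t)%:E).
  by move=> ih; under eq_fun do rewrite EFinM; exact: integrableZl.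
move=> [f1 f2]; split.
- under [EFin \o _]eq_fun do rewrite /= ReM EFinB.
  by apply: integrableB => //; exact: iZ.
- under [EFin \o _]eq_fun do rewrite /= ImM EFinD.
  by apply: integrableD => //; exact: iZ.
Qed.

(** Multiplication by a complex scalar mixes the two parts, which is why both have
    to be integrable even for one component of the conclusion. *)
Lemma complex_integralZ z f : cintegrable D f ->
  complex_integral D (fun t => z * f t) = z * complex_integral D f.
Proof.
have iZ (r : R) h : lebesgue_measure.-integrable D (EFin \o h) ->
    lebesgue_measure.-integrable D (EFin \o (fun t => r * h t)).
  move=> ih; under [EFin \o _]eq_fun do rewrite /= EFinM; exact: integrableZl.
move=> [f1 f2]; rewrite /complex_integral.
under eq_Rintegral do rewrite ReM.
under [X in _ +i* X]eq_Rintegral do rewrite ImM.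
rewrite RintegralB ?RintegralD//; do ?exact: iZ.
by rewrite !RintegralZl//; case: z => a b; simpc.
Qed.

Lemma cintegrable0 : cintegrable D (fun=> 0).
Proof. by split; exact: integrable0. Qed.

Lemma complex_integral0 : complex_integral D (fun=> 0) = 0.
Proof. by rewrite /complex_integral /Rintegral !integral0. Qed.

Lemma cintegrable_sum (F : nat -> R -> R[i]) N :
  (forall k, cintegrable D (F k)) ->
  cintegrable D (fun t => \sum_(0 <= k < N) F k t).
Proof.
move=> iF; elim: N => [|N IH].
  by under eq_fun do rewrite big_geq//; exact: cintegrable0.
by under eq_fun do rewrite big_nat_recr//=; exact: cintegrableD.
Qed.

Lemma complex_integral_sum (F : nat -> R -> R[i]) N :
  (forall k, cintegrable D (F k)) ->
  complex_integral D (fun t => \sum_(0 <= k < N) F k t) =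
  \sum_(0 <= k < N) complex_integral D (F k).
Proof.
move=> iF; elim: N => [|N IH].
  by under eq_fun do rewrite big_geq//; rewrite big_geq// complex_integral0.
under eq_fun do rewrite big_nat_recr//=.
by rewrite complex_integralD ?IH ?big_nat_recr//; exact: cintegrable_sum.
Qed.

(** The constant M is an admissible dominating function because D has finite
    measure; measurability of the limit is inherited from the f_n. *)
Lemma Rintegral_dominated_cvg (f_ : nat -> R -> R) (f : R -> R) (M : R) :
  (lebesgue_measure D < +oo)%E ->
  (forall n, lebesgue_measure.-integrable D (EFin \o f_ n)) ->
  (forall t, D t -> f_ ^~ t @ \oo --> f t) ->
  (forall n t, D t -> `|f_ n t| <= M) ->
  (fun n => \int[lebesgue_measure]_(t in D) f_ n t) @ \oo -->
    \int[lebesgue_measure]_(t in D) f t.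
Proof.
move=> fD if_ cvf leM.
have mf_ n := measurable_int lebesgue_measure (if_ n).
have cvEf t : D t -> (EFin \o f_ n) t @[n --> \oo] --> (EFin \o f) t.
  by move=> Dt; apply: cvg_EFin; [exact: nearW|exact: cvf].
have mf := emeasurable_fun_cvg _ (EFin \o f) mf_ cvEf.
have iM : lebesgue_measure.-integrable D (EFin \o cst M).
  by apply: measurable_bounded_integrable => //; exact: bounded_cst.
have aecv : {ae lebesgue_measure, forall t, D t ->
    (EFin \o f_ n) t @[n --> \oo] --> (EFin \o f) t} by exact: aeW.
have aeM : {ae lebesgue_measure, forall t n, D t ->
    (`|(EFin \o f_ n) t| <= (EFin \o cst M) t)%E}.
  by apply: aeW => t n Dt /=; rewrite lee_fin leM.
have [intf _ cvint] :=
  @dominated_convergence _ _ _ lebesgue_measure D mD _ _ _ mf_ mf aecv iM aeM.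
apply: fine_cvg; rewrite /Rintegral fineK//.
exact: integrable_fin_num.
Qed.

Lemma complex_dominated_cvg (f_ : nat -> R -> R[i]) (f : R -> R[i]) (M : R) :
  (lebesgue_measure D < +oo)%E ->
  (forall n, cintegrable D (f_ n)) ->
  (forall t, D t -> (f_ ^~ t : nat -> R[i]^o) @ \oo --> (f t : R[i]^o)) ->
  (forall n t, D t -> `|f_ n t| <= M%:C) ->
  ((fun n => complex_integral D (f_ n)) : nat -> R[i]^o) @ \oo -->
    (complex_integral D f : R[i]^o).
Proof.
move=> fD if_ cvf leM; apply/cvg_complexP; split => /=.
- apply: (@Rintegral_dominated_cvg _ _ M) => // [n|t Dt|n t Dt].
  + by case: (if_ n).
  + by have /cvg_complexP[] := cvf t Dt.
  + by rewrite -lecR (le_trans (normc_ge_Re _))// leM.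
- apply: (@Rintegral_dominated_cvg _ _ M) => // [n|t Dt|n t Dt].
  + by case: (if_ n).
  + by have /cvg_complexP[] := cvf t Dt.
  + by rewrite -lecR (le_trans (normc_ge_Im _))// leM.
Qed.

End ComplexIntegral.

(** * Cauchy's coefficient formula on a circle *)

(** The point exp(i t) of the unit circle. *)
Definition cis (R : realType) (t : R) : R[i] := cos t +i* sin t.

Section Circle.
Context (R : realType).
Implicit Types (t w eps : R).

Lemma cisD t w : cis (t + w) = cis t * cis w.
Proof. by rewrite /cis cosD sinD; simpc; rewrite [X in _ +i* X]addrC. Qed.

Lemma cis0 : cis 0 = 1 :> R[i].
Proof. by rewrite /cis cos0 sin0. Qed.

Lemma norm_cis t : `|cis t| = 1.
Proof. by rewrite normc_def /= cos2Dsin2 sqrtr1. Qed.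

Lemma cis_neq0 t : cis t != 0.
Proof. by rewrite -normr_gt0 norm_cis. Qed.

Lemma cis_natmul t k : cis (k%:R * t) = cis t ^+ k.
Proof.
elim: k => [|k IH]; first by rewrite mul0r cis0.
by rewrite -natr1 mulrDl mul1r cisD IH exprSr.
Qed.

Lemma cis_ratio t k b : cis ((k%:R - b%:R) * t) = cis t ^+ k / cis t ^+ b.
Proof.
apply: (canRL (mulfK _)); first by rewrite expf_neq0// cis_neq0.
by rewrite -!cis_natmul -cisD; congr cis; ring.
Qed.

Lemma cis_2pi : cis (2 * pi) = 1 :> R[i].
Proof. by rewrite mulr_natl /cis cos2pi sin2pi. Qed.

Lemma measurable_turn : measurable (`[0, 2 * pi] : set R).
Proof. exact: measurable_itv. Qed.

Lemma cintegrable_cis w : cintegrable `[0, 2 * pi] (fun t => cis (w * t)).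
Proof.
have cw t : {for t, continuous (fun x : R => w * x)}.
  by apply: cvgM; [exact: cvg_cst|exact: cvg_id].
split; apply: continuous_compact_integrable; try exact: segment_compact.
- apply: continuous_subspaceT => t.
  by apply: (@continuous_comp _ _ _ (fun x => w * x) cos) => //; exact: continuous_cos.
- apply: continuous_subspaceT => t.
  by apply: (@continuous_comp _ _ _ (fun x => w * x) sin) => //; exact: continuous_sin.
Qed.

(** An integrand with a primitive taking equal values at both ends of the turn
    integrates to zero, by the fundamental theorem of calculus. *)
Lemma Rintegral_turn_eq0 (f F : R -> R) : continuous f ->
  (forall t : R, is_derive t 1 F (f t)) -> F 0 = F (2 * pi) ->
  \int[lebesgue_measure]_(t in `[0, 2 * pi]) f t = 0.
Proof.
move=> cf dF F02.
have cF t : {for t, continuous F}.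
  by apply: differentiable_continuous; apply/derivable1_diffP; case: (dF t).
rewrite /Rintegral (@continuous_FTC2 _ f F) ?mulr_gt0 ?pi_gt0//.
- by rewrite F02 subee.
- exact: continuous_subspaceT.
- split.
  + by move=> t _; case: (dF t).
  + by apply: cvg_at_right_filter; exact: cF.
  + by apply: cvg_at_left_filter; exact: cF.
- by move=> t _; rewrite derive1E; case: (dF t).
Qed.

(** The second hypothesis says that w is an integer; in this form the primitives
    sin (w t) / w and - cos (w t) / w return to their initial values at once, and
    negative frequencies need no separate treatment. *)
Lemma integral_cis_eq0 w : w != 0 -> cis (w * (2 * pi)) = 1 ->
  complex_integral `[0, 2 * pi] (fun t => cis (w * t)) = 0.
Proof.
move=> w0 [cw sw].
have cont (g : R -> R) : continuous g -> continuous (fun t : R => g (w * t)).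
  move=> cg t; apply: (@continuous_comp _ _ _ (fun x => w * x) g) => //.
    by apply: cvgM; [exact: cvg_cst|exact: cvg_id].
  exact: cg.
have dsin t : is_derive t 1 (fun t => w^-1 * sin (w * t)) (cos (w * t)).
  by apply: is_derive_eq; rewrite /GRing.scale /=; field.
have dcos t : is_derive t 1 (fun t => - (w^-1 * cos (w * t))) (sin (w * t)).
  by apply: is_derive_eq; rewrite /GRing.scale /=; field.
rewrite /complex_integral /cis /=.
rewrite (Rintegral_turn_eq0 (cont _ (@continuous_cos R)) dsin).
  rewrite (Rintegral_turn_eq0 (cont _ (@continuous_sin R)) dcos)//.
  by rewrite mulr0 cos0 cw.
by rewrite mulr0 sin0 sw.
Qed.

Lemma integral_cis_nat k b :
  complex_integral `[0, 2 * pi] (fun t : R => cis ((k%:R - b%:R) * t)) =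
  if k == b then (2 * pi)%:C else 0.
Proof.
case: eqVneq => [->|kb].
  have -> : (fun t : R => cis ((b%:R - b%:R) * t)) = fun=> 1.
    by apply/funext => t; rewrite subrr mul0r cis0.
  rewrite /complex_integral !Rintegral_cst//= lebesgue_measure_itv/=.
  by rewrite lte_fin mulr_gt0 ?pi_gt0//= subr0 mul0r mul1r.
rewrite integral_cis_eq0 ?subr_eq0 ?eqr_nat//.
by rewrite cis_ratio cis_2pi !expr1n divr1.
Qed.

(** Cauchy's coefficient formula for a power series dominated by a real series
    that converges at the radius of the circle.  The partial sums satisfy it
    exactly once they contain the term of index b, and dominated convergence
    carries it over to the sum. *)
Theorem cauchy_coefficient eps (c : nat -> R[i]) (a : nat -> R)
    (G : R[i] -> R[i]) (b : nat) :
  0 < eps -> (forall k, `|c k| <= (a k)%:C) ->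
  cvgn (series (fun k => a k * eps ^+ k)) ->
  (forall y, `|y| = eps%:C ->
    (series (fun k => c k * y ^+ k) : nat -> R[i]^o) @ \oo --> (G y : R[i]^o)) ->
  ((2 * pi)%:C * 'i%C)^-1 * circle_integral eps (fun y => G y / y ^+ b / y) = c b.
Proof.
move=> e0 ca cva cvG.
have eC0 : eps%:C != 0 :> R[i] by rewrite (inj_eq (@complexI _)) gt_eqF.
pose y t := eps%:C * cis t.
have ny t : `|y t| = eps%:C.
  by rewrite normrM norm_cis mulr1 norm_realc gtr0_norm.
have y0 t : y t != 0 by rewrite mulf_neq0// cis_neq0.
(* On the circle dy = 'i y dt, so the factor 1 / y of dy / y cancels and the term
   of index k contributes the frequency k - b. *)
pose z k : R[i] := 'i * c k * eps%:C ^+ k / eps%:C ^+ b.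
pose S N t : R[i] := \sum_(0 <= k < N) z k * cis ((k%:R - b%:R) * t).
have SE N t : S N t = 'i / y t ^+ b * series (fun k => c k * y t ^+ k) N.
  rewrite /S /series /= mulr_sumr; apply: eq_bigr => k _.
  by rewrite /z cis_ratio /y !exprMn invfM; ring.
have mD := measurable_turn.
have iS k : cintegrable `[0, 2 * pi] (fun t => z k * cis ((k%:R - b%:R) * t)).
  by apply: cintegrableZ => //; exact: cintegrable_cis.
have intS N : (b < N)%N -> complex_integral `[0, 2 * pi] (S N) = (2 * pi)%:C * 'i * c b.
  move=> bN; rewrite (complex_integral_sum mD N iS).
  under eq_bigr => k _.
    rewrite complex_integralZ//; last exact: cintegrable_cis.
    rewrite integral_cis_nat.
    over.
  (* Orthogonality leaves the term of index b, where the powers of eps cancel. *)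
  rewrite big_mkord (bigD1 (Ordinal bN))//= eqxx big1 ?addr0.
    by rewrite /z mulfK ?expf_neq0//; ring.
  by move=> k; rewrite -val_eqE /= => /negPf ->; rewrite mulr0.
have -> : circle_integral eps (fun y => G y / y ^+ b / y) =
    complex_integral `[0, 2 * pi] (fun t => 'i / y t ^+ b * G (y t)).
  congr complex_integral; apply/funext => t.
  have -> : eps%:C * (- sin t +i* cos t) = 'i * y t.
    by rewrite /y mulrCA; congr (_ * _); rewrite /cis; simpc.
  rewrite -/(cis t) -/(y t).
  by field; rewrite ?expf_neq0 ?y0.
have cvS t : (S ^~ t : nat -> R[i]^o) @ \oo --> ('i / y t ^+ b * G (y t) : R[i]^o).
  under eq_fun do rewrite SE.
  by apply: cvgMr; apply: cvG.
have bS N t : `|S N t| <= (limn (series (fun k => a k * eps ^+ k)) / eps ^+ b)%:C.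
  rewrite SE normrM normf_div norm_i normrX ny mul1r mulrC rmorphM fmorphV rmorphXn /=.
  rewrite ler_wpM2r ?invr_ge0 ?exprn_ge0 ?ler0c ?(ltW e0)//.
  have a0 k : 0 <= a k by rewrite -ler0c (le_trans _ (ca k)).
  apply: (@le_trans _ _ (series (fun k => a k * eps ^+ k) N)%:C).
    rewrite /series /= rmorph_sum /= (le_trans (ler_norm_sum _ _ _))// ler_sum// => k _.
    by rewrite normrM normrX ny rmorphM rmorphXn /= ler_wpM2r// exprn_ge0// ler0c ltW.
  rewrite lecR; apply: nondecreasing_cvgn_le => //.
  by apply: nondecreasing_series => k _ _; rewrite mulr_ge0// exprn_ge0// ltW.
have fD : (@lebesgue_measure R [set` `[0, 2 * pi]%R] < +oo)%E.
  by rewrite lebesgue_measure_itv/=; case: ifPn => // _; rewrite -EFinB ltry.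
have cvI := @complex_dominated_cvg _ _ mD S _ _ fD
  (fun N => cintegrable_sum mD N iS) (fun t _ => cvS t) (fun N t _ => bS N t).
have <- : (2 * pi)%:C * 'i * c b =
    complex_integral `[0, 2 * pi] (fun t => 'i / y t ^+ b * G (y t)).
  have cvE : ((fun N => complex_integral `[0, 2 * pi] (S N)) : nat -> R[i]^o) @ \oo -->
      ((2 * pi)%:C * 'i * c b : R[i]^o).
    apply: cvg_near_cst; exists b.+1 => // N /= bN; exact: intS.
  by apply: cvg_unique cvE cvI; exact: norm_hausdorff.
rewrite mulKf// mulf_neq0// -?normr_gt0 ?norm_i//.
by rewrite normr_gt0 (inj_eq (@complexI _)) mulf_neq0// gt_eqF// pi_gt0.
Qed.

End Circle.

(** * The binomial series *)

(** The right-hand side is the sum of the whole series.  By Pascal's rule,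
    multiplying by 1 - x the partial sum for a + 1 gives the one for a minus a
    nonnegative boundary term, so induction on a reduces to the geometric
    series. *)
Lemma binomial_partial_sum_le (R : realType) (x : R) (a N : nat) :
  0 <= x -> x < 1 ->
  \sum_(0 <= k < N) 'C(k + a, a)%:R * x ^+ k <= (1 - x)^-1 ^+ a.+1.
Proof.
move=> x0 x1; have y0 : 0 < 1 - x by rewrite subr_gt0.
have pos b : 0 <= \sum_(0 <= k < N) 'C(k + b, b)%:R * x ^+ k.
  by apply: sumr_ge0 => k _; rewrite mulr_ge0 ?exprn_ge0.
elim: a => [|a IH].
  rewrite expr1 -[_^-1]mul1r ler_pdivlMr// mulrC.
  under eq_bigr do rewrite bin0 mul1r.
  rewrite big_mkord -(opprB x) mulNr -subrX1 opprB.
  by rewrite gerBl exprn_ge0.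
rewrite exprS mulrC ler_pdivlMr// mulrC; apply: le_trans IH.
rewrite mulrBl mul1r mulr_sumr lerBlDr.
elim: N {pos} => [|N _].
  by rewrite !big_geq// addr0.
(* The first two sums are shifted by one index and the third loses its last term,
   so that Pascal's rule applies termwise. *)
rewrite [leLHS]big_nat_recl// [X in _ <= X + _]big_nat_recl//.
rewrite [X in _ <= _ + X]big_nat_recr//=.
rewrite !add0n !binn -!addrA lerD2l addrA -big_split /=.
rewrite [leLHS](eq_bigr (fun i => 'C(i.+1 + a, a)%:R * x ^+ i.+1 +
   x * ('C(i + a.+1, a.+1)%:R * x ^+ i))); last first.
  by move=> i _; rewrite addSn addnS binS natrD exprS; ring.
by rewrite lerDl !mulr_ge0 ?exprn_ge0.
Qed.

Lemma is_cvg_binomial_series (R : realType) (x : R) (a : nat) :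
  0 <= x -> x < 1 -> cvgn (series (fun k => 'C(k + a, a)%:R * x ^+ k)).
Proof.
move=> x0 x1; apply: nondecreasing_is_cvgn.
  by apply: nondecreasing_series => k _ _; rewrite mulr_ge0 ?exprn_ge0.
by exists ((1 - x)^-1 ^+ a.+1) => _ [N _ <-]; exact: binomial_partial_sum_le.
Qed.

Lemma fact_ratio_bin (F : numFieldType) (k a : nat) :
  (k + a)`!%:R / k`!%:R = a`!%:R * 'C(k + a, a)%:R :> F.
Proof.
apply: (canLR (mulfK _)); first by rewrite pnatr_eq0 -lt0n fact_gt0.
by rewrite -!natrM -(bin_fact (leq_addl k a)) addnK mulnCA mulnA.
Qed.

Lemma is_cvg_fact_ratio_majorant (R : realType) (x L : R) (a : nat) :
  0 <= x -> x < 1 ->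
  cvgn (series (fun k => L * ((k + a)`!%:R / k`!%:R) * x ^+ k)).
Proof.
move=> x0 x1.
under eq_fun do rewrite fact_ratio_bin mulrA -mulrA.
by apply: is_cvg_seriesZ; exact: is_cvg_binomial_series.
Qed.

(** The integrals that occur in the theorem.  The constant K is kept apart from L
    because only L is inside the sum defining the period of the blow-up; to apply
    Cauchy's formula it is moved into the coefficients. *)
Lemma contour_binomial (R : realType) (eps : R) (K L : R[i]) (a b : nat) :
  0 < eps -> eps < 1 ->
  ((2 * pi)%:C * 'i%C)^-1 *
  circle_integral eps (fun y => K / y ^+ b *
    limn (series (fun k => (L * ((k + a)`!%:R / k`!%:R) * y ^+ k : R[i]^o))) / y) =
  K * L * ((b + a)`!%:R / b`!%:R).
Proof.
move=> e0 e1.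
pose u k : R[i] := L * ((k + a)`!%:R / k`!%:R).
pose c k : R[i] := K * u k.
pose G y : R[i] := K * limn (series (fun k => (u k * y ^+ k : R[i]^o))).
pose A (M : R[i]) k : R := Re `|M| * ((k + a)`!%:R / k`!%:R).
have normE (M : R[i]) k : `|M * ((k + a)`!%:R / k`!%:R)| = (A M k)%:C.
  rewrite normrM normf_div !normr_nat /A rmorphM fmorph_div !rmorph_nat.
  by rewrite [X in _ = X * _]RRe_real ?normr_real.
rewrite -mulrA -[RHS]/(c b) -(@cauchy_coefficient _ eps c (A (K * L)) G b e0).
- congr (_ * circle_integral _ _); apply/funext => y.
  by congr (_ / _); rewrite /G mulrAC.
- by move=> k; rewrite /c /u mulrA normE.
- by apply: is_cvg_fact_ratio_majorant => //; exact: ltW.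
move=> y ny.
have -> : (series (fun k => c k * y ^+ k) : nat -> R[i]^o) =
    (fun n => K * series (fun k => (u k * y ^+ k : R[i]^o)) n).
  apply/funext => n; rewrite /series /= mulr_sumr.
  by apply: eq_bigr => k _; rewrite /c mulrA.
apply: cvgMr.
apply: (is_cvg_series_complex (a := fun k => A L k * eps ^+ k)).
  by move=> k; rewrite normrM normrX ny normE -rmorphXn -rmorphM.
by apply: is_cvg_fact_ratio_majorant => //; exact: ltW.
Qed.

(** * The period identity *)

Section Periods.
Context (R : realType) (n m r s : nat) (Y : smooth_projective_toric R n m).
Context (B : nef_basis Y r) (P : nef_partition Y s) (Q : refinement P).

Lemma effective_pairS_ge0 (J : {set 'I_m}) d :
  effective B d -> 0 <= pairS B J d.
Proof. by move=> /forallP eff; apply: sumr_ge0 => j _; exact: eff. Qed.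

Lemma pairS_group0 d :
  pairS B (nef_group P ord0) d = pairS B (group01 Q) d + pairS B (group02 Q) d.
Proof.
rewrite /pairS (group0_split Q) -bigU; last exact: group0_disj.
by apply: eq_bigl => j; rewrite !inE.
Qed.

(** Splitting off the group l = 0 makes the factor shared by the four periods
    appear. *)
Lemma period_X_factor d : effective B d ->
  period_X B P d =
  common_factor B P d * (zfact (pairS B (nef_group P ord0) d))%:R.
Proof.
move=> eff; rewrite /period_X eff /common_factor (bigD1 ord0)//= natrM.
by rewrite -mulrA mulrC.
Qed.

End Periods.

Theorem theorem1p1 (R : realType) (n m r s : nat)
    (Y : smooth_projective_toric R n m) (B : nef_basis Y r)
    (P : nef_partition Y s) (Q : refinement P) (eps : R) :
  0 < eps -> eps < 1 ->
  hadamard (period_X B P) (period_X0 B Q) =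
  contour_dy_over_y eps (hadamard (period_X1 B Q) (period_tX2 B Q)).
Proof.
move=> e0 e1; apply/funext => d; rewrite /contour_dy_over_y /hadamard.
have [eff|neff] := boolP (effective B d); last first.
  rewrite /period_X (negPf neff) mul0r.
  have -> : (fun y => (period_X1 B Q d * period_tX2 B Q d) y / y) = fun=> 0.
    by apply/funext => y /=; rewrite fctE /period_X1 (negPf neff) !mul0r.
  rewrite /circle_integral.
  have -> : (fun t : R => 0 * (eps%:C * (- sin t +i* cos t))) = fun=> 0.
    by apply/funext => t; rewrite mul0r.
  by rewrite complex_integral0 mulr0.
rewrite period_X_factor// (pairS_group0 B Q) /period_X0 eff.
have natE (J : {set 'I_m}) : exists k : nat, pairS B J d = k.
  by case: (pairS B J d) (effective_pairS_ge0 J eff) => // k _; exists k.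
have [[a aE] [b bE]] := (natE (group01 Q), natE (group02 Q)).
rewrite aE bE; set K := common_factor B P d.
have -> : (fun y => (period_X1 B Q d * period_tX2 B Q d) y / y) =
    (fun y => (K * a`!%:R * b`!%:R) / y ^+ b *
      limn (series (fun k =>
        (K * b`!%:R * ((k + a)`!%:R / k`!%:R) * y ^+ k : R[i]^o))) / y).
  apply/funext => y; rewrite fctE /period_X1 /period_tX2 eff aE bE -/K /=.
  congr (_ * _ / _); rewrite [X in series X](_ : _ = fun k =>
    (K * b`!%:R * ((k + a)`!%:R / k`!%:R) * y ^+ k : R[i]^o))//.
  by apply/funext => k; rewrite /zfact /=; congr (_ * _); ring.
rewrite contour_binomial// /zfact /= [(b + a)%N]addnC.
field; by rewrite pnatr_eq0 -lt0n fact_gt0.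
Qed.
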